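(* Consider the following algorithm for the $k$-framed matroid secretary problem: set $\mathrm{ALG}\gets\emptyset$, $B'\gets\emptyset$, draw $s\sim\mathrm{Bin}(n,p)$; for $i=s+1,\dots,n$: if $r_i\in\mathrm{OPT}(R_i)$ and $C(B,r_i)\cap B'=\emptyset$, set $\mathrm{ALG}\gets\mathrm{ALG}+r_i$ and $B'\gets B'+\pi_{\mathrm{OPT}(R_i)}(r_i)$; return $\mathrm{ALG}$. This algorithm has forbidden sets of size $k$. With $p=p(k)$ it is $\alpha(k)$ probability-competitive for $k$-framed matroids.
   Context: $k$-framed matroid: $\mathcal{M}=(R,\mathcal{I})$, $|R|=n$, such that there is a matroid $\mathcal{M}^B$ on $R\cup B$, $B\cap R=\emptyset$, whose restriction to $R$ is $\mathcal{M}$, with $B$ a base of $\mathcal{M}^B$ and each element of $R$ spanned by at most $k$ elements of $B$. The algorithm has access to $B$ and an independence oracle of $\mathcal{M}^B$. For $r\in R$, $C(B,r)=\{y\in B: B+r-y \text{ is independent in } \mathcal{M}^B\}$. For each independent $X$ of $\mathcal{M}$, $\pi_X:X\to B$ is a fixed canonical (independent of arrival order) injection with $B+x-\pi_X(x)$ independent in $\mathcal{M}^B$ for all $x\in X$. Ordinal MSP setting: total order $\succ$ on $R$; $\mathrm{OPT}(Q)$ is the greedy (lexicographically maximum w.r.t. $\succ$) base of $Q\subseteq R$, $\mathrm{OPT}=\mathrm{OPT}(R)$; elements arrive in uniformly random order $r_1,\dots,r_n$, $R_t=\{r_1,\dots,r_t\}$. Probability-competitive: $\Pr(e\in\mathrm{ALG})\ge1/\alpha$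 for all $e\in\mathrm{OPT}$. Forbidden sets of size $k$: (1) output always independent; (2) draws $s\sim\mathrm{Bin}(n,p)$ and accepts none of the first $s$ elements; (3) for every $(X,Y,r^* )$ with $Y\subseteq R$, $r^*\in\mathrm{OPT}(Y)$, $X\subseteq Y\setminus\{r^*\}$ there is $\mathcal{F}(X,Y,r^* )\subseteq X$ with at most $k$ elements such that for every $t\ge s+1$, if $r_t\in\mathrm{OPT}(R_t)$ and $r_j\notin\mathcal{F}(R_j,R_t,r_t)$ for all $j\in\{s+1,\dots,t-1\}$ then $r_t$ is selected. $(p(1),\alpha(1))=(1/e,e)$; for $k\ge2$, $(p(k),\alpha(k))=(k^{-1/(k-1)},k^{k/(k-1)})$. *)

(* Defs.v *)
From mathcomp Require Import all_classical all_reals all_analysis.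
From mathcomp Require Import all_boot all_order all_algebra.

Set Implicit Arguments.
Unset Strict Implicit.
Unset Printing Implicit Defensive.

Import Order.TTheory GRing.Theory Num.Theory.
Local Open Scope ring_scope.

Record matroid (E : finType) := Matroid {
  indep : {set {set E}};
  indep0 : finset.set0 \in indep;
  indepS : forall I J : {set E}, I \subset J -> J \in indep -> I \in indep;
  indep_aug : forall I J : {set E}, I \in indep -> J \in indep ->
    (#|I| < #|J|)%N -> exists2 x, x \in J :\: I & x |: I \in indep }.

Definition is_base (E : finType) (M : matroid E) (A : {set E}) : bool :=
  maxset (mem (indep M)) A.

Definition matroid_rank (E : finType) (M : matroid E) (A : {set E}) : nat :=
  (\max_(I in indep M | I \subset A) #|I|)%N.

Definition matroid_span (E : finType) (M : matroid E) (A : {set E}) : {set E} :=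
  [set x | matroid_rank M (x |: A) == matroid_rank M A].

(* The frame [B], seen inside the disjoint union [T + B] of the ground set of
   [M] and of the frame. *)
Definition frame (T B : finType) : {set T + B} := inr @: [set: B].

Definition framed (k : nat) (T B : finType) (M : matroid T)
    (MB : matroid (T + B)%type) : Prop :=
  [/\ forall I : {set T}, (I \in indep M) = (inl @: I \in indep MB),
      is_base MB (frame T B) &
      forall x : T, exists2 A : {set B},
        (#|A| <= k)%N & inl x \in matroid_span MB (inr @: A)].

Definition exchange (T B : finType) (x : T) (y : B) : {set T + B} :=
  (inl x |: frame T B) :\ inr y.

(* The elements of the frame that [x] can replace, written [C(B, x)]. *)
Definition frame_circuit (T B : finType) (MB : matroid (T + B)%type) (x : T)
    : {set B} :=
  [set y | exchange x y \in indep MB].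

(* [pi X x] is only meaningful for [X] independent and [x \in X]. *)
Definition canonical_injections (T B : finType) (M : matroid T)
    (MB : matroid (T + B)%type) (pi : {set T} -> T -> B) : Prop :=
  forall X : {set T}, X \in indep M ->
    {in X &, injective (pi X)} /\
    {in X, forall x, exchange x (pi X x) \in indep MB}.

(* The greedy base of [Q]: larger elements of [T] are better, and [>=%O] sorts
   the best element first. *)
Definition OPT (d : Order.disp_t) (T : finOrderType d) (M : matroid T)
    (Q : {set T}) : {set T} :=
  foldl (fun A x => if x |: A \in indep M then x |: A else A) finset.set0
    (sort >=%O (enum Q)).

Definition arrival_orders (T : finType) : {set #|T|.-tuple T} :=
  [set r : #|T|.-tuple T | uniq r].

(* The set [R_t] of the first [t] arrivals.  Positions in [r] start at 0, so
   the [t]-th arrival is the entry of index [t - 1]. *)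
Definition arrived (T : finType) (r : seq T) (t : nat) : {set T} :=
  [set x in take t r].

(* An algorithm draws a sample size [s] from [sample_law], independently of the
   arrival order; [output s r] is the set it selects on the arrival order [r]. *)
Record sample_algorithm (R : realType) (T : finType) := SampleAlgorithm {
  sample_law : probability nat R;
  output : nat -> #|T|.-tuple T -> {set T} }.

Definition prob_selected (R : realType) (T : finType)
    (A : sample_algorithm R T) (e : T) : \bar R :=
  (\int[sample_law A]_s
    ((#|[set r in arrival_orders T | e \in output A s r]|%:R
       / #|arrival_orders T|%:R)%:E))%E.

Definition probability_competitive (R : realType) (d : Order.disp_t)
    (T : finOrderType d) (M : matroid T) (alpha : R)
    (A : sample_algorithm R T) : Prop :=
  forall e : T, e \in OPT M [set: T] -> ((alpha^-1)%:E <= prob_selected A e)%E.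

(* With indices starting at 0, [t] and [j] stand for the arrivals [r_(t+1)] and
   [r_(j+1)], and [arrived r t.+1] is [R_(t+1)]. *)
Definition has_forbidden_sets (R : realType) (d : Order.disp_t)
    (T : finOrderType d) (M : matroid T) (p : R) (k : nat)
    (A : sample_algorithm R T) : Prop :=
  [/\ forall (s : nat) (r : #|T|.-tuple T), (s <= #|T|)%N ->
        r \in arrival_orders T -> output A s r \in indep M,
      (forall U, sample_law A U = binomial_prob #|T| p U) /\
      (forall (s : nat) (r : #|T|.-tuple T), (s <= #|T|)%N ->
        r \in arrival_orders T ->
        forall i : 'I_#|T|, (i < s)%N -> tnth r i \notin output A s r) &
      exists F : {set T} -> {set T} -> T -> {set T},
        (forall (X Y : {set T}) (x : T),
          x \in OPT M Y -> X \subset Y :\ x ->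
          F X Y x \subset X /\ (#|F X Y x| <= k)%N) /\
        (forall (s : nat) (r : #|T|.-tuple T), (s <= #|T|)%N ->
          r \in arrival_orders T ->
          forall t : 'I_#|T|, (s <= t)%N ->
          tnth r t \in OPT M (arrived r t.+1) ->
          (forall j : 'I_#|T|, (s <= j < t)%N ->
            tnth r j \notin F (arrived r j.+1) (arrived r t.+1) (tnth r t)) ->
          tnth r t \in output A s r)].

(* Processes the arrivals [rest] in order; [seen] is the set of earlier
   arrivals and [st] is the current pair [(ALG, B')]. *)
Fixpoint framed_run (d : Order.disp_t) (T : finOrderType d) (B : finType)
    (M : matroid T) (MB : matroid (T + B)%type) (pi : {set T} -> T -> B)
    (seen : {set T}) (st : {set T} * {set B}) (rest : seq T)
    : {set T} * {set B} :=
  if rest is x :: rest' then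
    let Ri := x |: seen in
    let st' :=
      if (x \in OPT M Ri) && (frame_circuit MB x :&: st.2 == finset.set0)
      then (x |: st.1, pi (OPT M Ri) x |: st.2)
      else st in
    framed_run M MB pi Ri st' rest'
  else st.

Definition framed_algorithm (R : realType) (d : Order.disp_t)
    (T : finOrderType d) (B : finType) (M : matroid T)
    (MB : matroid (T + B)%type) (pi : {set T} -> T -> B) (p : R)
    : sample_algorithm R T :=
  SampleAlgorithm (binomial_prob #|T| p)
    (fun s r => (framed_run M MB pi (arrived r s)
                   (finset.set0, finset.set0) (drop s r)).1).

(* The junk value of both at [k = 0] is never used. *)
Definition sampling_prob (R : realType) (k : nat) : R :=
  if k == 1%N then (expR 1)^-1
  else k%:R `^ (- (1 / (k%:R - 1))).

Definition competitive_ratio (R : realType) (k : nat) : R :=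
  if k == 1%N then expR 1
  else k%:R `^ (k%:R / (k%:R - 1)).

(* Main.v *)
(** If [r_1, .., r_m] are the accepted elements in order and [y_i] is the frame
    element charged by [r_i], then [r_j], [j > i], is spanned by the frame minus
    [y_i] while [r_i] is not; so no circuit of accepted elements has an earliest
    member, and the output is independent.  An element can only be blocked by an
    earlier [r_j] whose charge lies in its frame circuit, which has at most [k]
    elements.

    Probabilistically, fix [e] in [OPT] and let [f s] be the probability that
    [e] arrives after the sample of size [s] and meets no forbidden element.
    Exchanging position [s] with a uniform earlier position gives
    [s * f (s - 1) >= s / n + (s - k) * f s].  With [G p] the average of [f] under
    the binomial law, this recursion becomes the differential inequality
    [p * G' p <= k * G p - p], whence
    [G p >= p ^ k * \int_p^1 t ^ (- k) dt]. *)

Require Import Defs.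
From mathcomp Require Import all_classical all_reals all_analysis.
From mathcomp Require Import all_boot all_order all_algebra perm ring.

Set Implicit Arguments.
Unset Strict Implicit.
Unset Printing Implicit Defensive.

Import Order.TTheory GRing.Theory Num.Theory.

Local Open Scope ring_scope.

(** * Spanning and the greedy algorithm in a matroid *)

Section Matroid.
Variables (E : finType) (M : matroid E).
Implicit Types (I J K : {set E}) (x e : E).

(** Here [I] spans [J] but not [e]. A maximal independent set between [J] and [e |: (I :|: J)] has
    more elements than [I]; if it missed [e], it would augment [I] by an element of [J]. *)
Lemma indep_setU1 I J e : I \in indep M -> e \notin I -> e |: I \in indep M ->
  J \in indep M -> {in J :\: I, forall y, y |: I \notin indep M} ->
  e |: J \in indep M.
Proof.
move=> II eI eII JI JsI.
pose P K := (K \in indep M) && (K \subset e |: (I :|: J)).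
have [|K /maxsetP[/andP[KI KU] Kmax] JK] := @maxset_exists _ P J.
  by rewrite /P JI finset.setUA finset.subsetUr.
have [eK|eK] := boolP (e \in K).
  by apply: indepS KI; rewrite subUset sub1set eK.
have KIJ : K \subset I :|: J.
  apply/fintype.subsetP => x xK; move/fintype.subsetP/(_ x xK): KU.
  by rewrite in_setU1 => /orP[/eqP xe|//]; rewrite -xe xK in eK.
have IK : (#|I| < #|K|)%N.
  have [|KI'] := ltnP #|K| #|e |: I|; last by rewrite cardsU1 eI in KI'.
  move=> /(indep_aug KI eII)[x]; rewrite in_setD => /andP[xK xeI] xKI.
  have xKK : x |: K = K.
    apply: Kmax (finset.subsetUr _ _); rewrite /P xKI subUset KU andbT sub1set.
    by move: xeI; rewrite !finset.inE => /orP[->//|->]; rewrite orbT.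
  by rewrite -xKK setU11 in xK.
have [y] := indep_aug II KI IK.
rewrite in_setD => /andP[yI yK] yII.
have /JsI : y \in J :\: I.
  by move/fintype.subsetP/(_ _ yK): KIJ; rewrite !finset.inE (negbTE yI).
by rewrite yII.
Qed.

(** The loop of [OPT] on an arbitrary list, so that splitting and filtering can be studied apart
    from sorting. *)
Definition greedy_step (A : {set E}) x :=
  if x |: A \in indep M then x |: A else A.
Definition greedy (l : seq E) : {set E} := foldl greedy_step finset.set0 l.

Lemma foldl_greedy_bounds (A : {set E}) (l : seq E) :
  A \subset foldl greedy_step A l /\
  foldl greedy_step A l \subset A :|: [set x in l].
Proof.
elim: l A => [|x l IH] A /=; first by rewrite subxx finset.subsetUl.
have [AG GA] := IH (greedy_step A x).
have As : A \subset greedy_step A x.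
  by rewrite /greedy_step; case: ifP => // _; exact: finset.subsetUr.
have sA : greedy_step A x \subset x |: A.
  by rewrite /greedy_step; case: ifP => // _; exact: finset.subsetUr.
split; first exact: subset_trans As AG.
apply: subset_trans GA _; rewrite set_cons finset.setUCA finset.setUA.
exact: finset.setSU.
Qed.

Lemma greedy_subset (l : seq E) : {subset greedy l <= l}.
Proof.
move=> x.
have [_ /fintype.subsetP/(_ x)/[apply]] := foldl_greedy_bounds finset.set0 l.
by rewrite finset.set0U finset.inE.
Qed.

Lemma greedy_indep (l : seq E) : greedy l \in indep M.
Proof.
elim/last_ind: l => [|l x IH]; first exact: indep0.
by rewrite /greedy -cats1 foldl_cat /= /greedy_step; case: ifP.
Qed.

Lemma greedy_max (l : seq E) x :
  x \in l -> x \notin greedy l -> x |: greedy l \notin indep M.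
Proof.
elim/last_ind: l => // l y IH.
rewrite mem_rcons in_cons /greedy -cats1 foldl_cat /= -/(greedy l) /greedy_step.
have [yI|yI] := boolP (y |: greedy l \in _); last first.
  by case/predU1P => [->|/IH].
rewrite in_setU1 negb_or; case/predU1P => [->|xl /andP[xy xg]].
  by rewrite eqxx.
apply: contra (IH xl xg); apply: indepS; apply: finset.setUS.
exact: finset.subsetUr.
Qed.

(** The decision on [x] is taken once, from what precedes it; later steps only add elements of
    [l2]. *)
Lemma mem_greedy_cat (l1 l2 : seq E) x :
  x \notin l1 -> x \notin l2 ->
  (x \in greedy (l1 ++ x :: l2)) = (x |: greedy l1 \in indep M).
Proof.
move=> xl1 xl2; rewrite /greedy foldl_cat /= -/(greedy l1).
have [lo /fintype.subsetP/(_ x) up] :=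
  foldl_greedy_bounds (greedy_step (greedy l1) x) l2.
rewrite /greedy_step in lo up *; case: ifP => xI; rewrite xI in lo up.
  by apply: (fintype.subsetP lo); exact: setU11.
apply: contraNF xl2 => /up; rewrite !finset.inE => /orP[/greedy_subset|//].
by rewrite (negbTE xl1).
Qed.

(** Thinning the list cannot reject [x]: the greedy set of the full prefix before [x] spans that of
    the thinned prefix, but does not span [x]. *)
Lemma greedy_filter (p : pred E) (l : seq E) x :
  uniq l -> p x -> x \in greedy l -> x \in greedy (filter p l).
Proof.
move=> ul px xg; have xl := greedy_subset xg; case/splitPr: xl ul xg => l1 l2.
rewrite cat_uniq /= negb_or => /and4P[_ /andP[xl1 _] xl2 _].
rewrite filter_cat /= px.
rewrite !mem_greedy_cat ?mem_filter ?negb_and ?xl1 ?xl2 ?orbT // => xI.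
apply: indep_setU1 (greedy_indep l1) _ xI (greedy_indep _) _.
  by apply: contra xl1; exact: greedy_subset.
move=> y; rewrite in_setD => /andP[yg /greedy_subset].
by rewrite mem_filter => /andP[_ yl1]; exact: greedy_max.
Qed.

End Matroid.

(** * The greedy base of a subset *)

Section Optimum.
Context {d : Order.disp_t} {T : finOrderType d} (M : matroid T).
Implicit Types (Q : {set T}) (x : T).

Lemma OPT_indep Q : OPT M Q \in indep M.
Proof. exact: greedy_indep. Qed.

Lemma OPT_subset Q : OPT M Q \subset Q.
Proof.
by apply/fintype.subsetP => x /greedy_subset; rewrite mem_sort mem_enum.
Qed.

(** Filtering commutes with sorting, so the sorted list of [Q] is a thinning of that of [T]. *)
Lemma OPT_restrict Q x : x \in OPT M [set: T] -> x \in Q -> x \in OPT M Q.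
Proof.
move=> xO xQ; rewrite /OPT.
have -> : enum Q = filter (mem Q) (enum [set: T]) by rewrite enum_setT.
rewrite -filter_sort; [|exact: ge_total|exact: ge_trans].
by apply: greedy_filter xO => //; rewrite sort_uniq enum_uniq.
Qed.

End Optimum.

(** * Runs of the algorithm on a framed matroid *)

Section FramedRun.
Context {d : Order.disp_t} {T : finOrderType d} {B : finType}.
Variables (M : matroid T) (MB : matroid (T + B)%type) (pi : {set T} -> T -> B).
Implicit Types (seen : {set T}) (st : {set T} * {set B}).

Local Notation C := (frame_circuit MB).
Local Notation run := (framed_run M MB pi).

(** The circuit lies in every part [A] of the frame that spans [x]: if [x] could replace some [y]
    outside [A], then [x] together with [A] would be independent. *)
Lemma card_frame_circuit k x : framed k M MB -> (#|C x| <= k)%N.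
Proof.
case=> _ /maxsetP[Bi Bmax] /(_ x)[A Ak xA].
apply: leq_trans Ak; apply/subset_leq_card/fintype.subsetP => y.
rewrite finset.inE => yI; apply: contraLR xA => yA.
rewrite finset.inE /matroid_rank neq_ltn; apply/orP; right.
have Asub : inr @: A \subset frame T B by apply: imsetS; exact: finset.subsetT.
have Ai : inr @: A \in indep MB by apply: indepS Bi.
have xAi : inl x |: inr @: A \in indep MB.
  apply: indepS yI; apply/fintype.subsetP => z; rewrite !finset.inE.
  case/predU1P => [->|zA] /=; first by rewrite eqxx.
  rewrite (fintype.subsetP Asub) // orbT andbT.
  by apply: contra yA => /eqP zy; rewrite zy mem_imset in zA => // ? ? [].
apply: (@leq_trans #|inl x |: inr @: A|); last first.
  by apply: leq_bigmax_cond; rewrite xAi subxx.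
rewrite cardsU1 (_ : inl x \notin _); last by apply/negP => /imsetP[].
by rewrite add1n ltnS; apply/bigmax_leqP => I /andP[_ /subset_leq_card].
Qed.

(* If [x] is the earliest accepted element of a circuit, the later ones are
   spanned by the frame without [y], whereas [x] is not. *)
Lemma indep_frame_circuit k x y (N : {set T}) : framed k M MB ->
  y \in C x -> N \in indep M -> {in N, forall z, y \notin C z} ->
  x |: N \in indep M.
Proof.
case=> indepE /maxsetP[Bi Bmax] _; rewrite finset.inE => yx NI NC.
have xB : inl x \notin frame T B by apply/negP => /imsetP[].
have exE z : exchange z y = inl z |: (frame T B :\ inr y).
  by apply/setP => u; rewrite !finset.inE; case: u.
rewrite indepE imsetU1; apply: (@indep_setU1 _ _ (frame T B :\ inr y)).
- by apply: indepS Bi; exact: finset.subsetDl.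
- by apply: contra xB; rewrite in_setD1 => /andP[].
- by rewrite -exE.
- by rewrite -indepE.
- move=> _ /setDP[/imsetP[z zN ->] _]; rewrite -exE.
  by have := NC _ zN; rewrite finset.inE.
Qed.

Hypothesis pi_canonical : canonical_injections M MB pi.

Lemma pi_OPT (Q : {set T}) x : x \in OPT M Q -> pi (OPT M Q) x \in C x.
Proof.
move=> xQ; rewrite finset.inE.
by have [_] := pi_canonical (OPT_indep M Q); apply.
Qed.

(** The induction on the list puts the earliest accepted element into [N] last. The clause on [st.2]
    then says that its charge avoids the frame circuits of all later accepted elements, as
    [indep_frame_circuit] requires. *)
Lemma framed_run_indep k seen st (l : seq T) : framed k M MB ->
  exists2 N : {set T}, (run seen st l).1 = N :|: st.1 &
    [/\ N \in indep M, {subset N <= l} &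
        {in N, forall x, C x :&: st.2 = finset.set0}].
Proof.
move=> fr; elim: l seen st => [|x l IH] seen st /=.
  exists finset.set0; first by rewrite finset.set0U.
  by split=> [|y|y]; rewrite ?indep0 ?finset.inE.
case: ifP => [/andP[xO /eqP xB]|_]; last first.
  have [N -> [NI Nl NC]] := IH (x |: seen) st; exists N => //; split=> // y /Nl.
  by rewrite in_cons orbC => ->.
set y := pi _ x.
have [N /= -> [NI Nl NC]] := IH (x |: seen) (x |: st.1, y |: st.2).
have NCy z : z \in N -> (y \notin C z) /\ C z :&: st.2 = finset.set0.
  move=> /NC; rewrite finset.setIUr => /eqP.
  rewrite finset.setU_eq0 => /andP[zy /eqP ->].
  split=> //; apply: contraTN zy => zy; apply/set0Pn; exists y.
  by rewrite !finset.inE in zy *; rewrite zy eqxx.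
exists (x |: N); first by rewrite finset.setUCA finset.setUA.
split=> [|z|z].
- apply: (@indep_frame_circuit k x y) => // [|z /NCy[]//]; exact: pi_OPT.
- by rewrite in_setU1 in_cons => /predU1P[->|/Nl ->]; rewrite ?eqxx ?orbT.
- by rewrite in_setU1 => /predU1P[->//|/NCy[]].
Qed.

Lemma framed_run_cat seen st (l1 l2 : seq T) :
  run seen st (l1 ++ l2) =
  run ([set x in l1] :|: seen) (run seen st l1) l2.
Proof.
elim: l1 seen st => [|x l1 IH] seen st /=.
  by congr (run _ _ _); apply/setP => y; rewrite !finset.inE.
rewrite IH; congr (run _ _ _); apply/setP => y; rewrite !finset.inE.
by rewrite orbCA orbA.
Qed.

Lemma framed_run_mono seen st (l : seq T) : st.1 \subset (run seen st l).1.
Proof.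
elim: l seen st => [|x l IH] seen st //=.
by case: ifP => _; apply: subset_trans (IH _ _); rewrite //= finset.subsetUr.
Qed.

(** Every new charge is traced back to the arrival that made it, in the terms in which forbidden
    sets are later defined. *)
Lemma framed_run_blocked seen st (l : seq T) y :
  y \in (run seen st l).2 ->
  y \in st.2 \/ exists l1 x l2, [/\ l = l1 ++ x :: l2,
    x \in OPT M (x |: ([set z in l1] :|: seen)) &
    y = pi (OPT M (x |: ([set z in l1] :|: seen))) x].
Proof.
elim/last_ind: l => [|l x IH]; first by left.
rewrite -cats1 framed_run_cat /=; case: ifP => [/andP[xO _]|_] yl.
  move: yl; rewrite in_setU1.
  move=> /predU1P[->|/IH[|[l1 [z [l2 [-> zO ->]]]]]]; last 2 first.
  - by left.
  - by right; exists l1, z, (l2 ++ [:: x]); rewrite -catA.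
  by right; exists l, x, [::].
case: (IH yl) => [|[l1 [z [l2 [-> zO ->]]]]]; first by left.
by right; exists l1, z, (l2 ++ [:: x]); rewrite -catA.
Qed.

End FramedRun.

(** * Counting arrival orders by permuting positions *)

Section ArrivalOrders.
Variable T : finType.
Implicit Types (r : #|T|.-tuple T) (e : T).
Local Notation n := #|T|.
Local Notation orders := (arrival_orders T).

Lemma orderP r e : uniq r -> (index e r < n)%N.
Proof.
move=> ur; rewrite -[X in (_ < X)%N](size_tuple r) index_mem.
have [_ ->] : (size r = size (enum T)) * (r =i enum T).
  apply: uniq_min_size => // [x _|]; first by rewrite mem_enum.
  by rewrite -cardE size_tuple.
by rewrite mem_enum.
Qed.

Lemma index_order r (i : 'I_n) : uniq r -> index (tnth r i) r = i.
Proof.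
by move=> ur; rewrite (tnth_nth (tnth r i)) index_uniq ?size_tuple.
Qed.

Lemma tnth_order_inj r : uniq r -> injective (tnth r).
Proof. by move/tuple_uniqP. Qed.

Lemma tnth_index r e (re : uniq r) : tnth r (Ordinal (orderP e re)) = e.
Proof.
by rewrite (tnth_nth e) /= nth_index // -index_mem size_tuple orderP.
Qed.

Lemma mem_arrived r m x : uniq r -> (m <= n)%N ->
  (x \in arrived r m) = (index x r < m)%N.
Proof. by move=> ro mn; rewrite finset.inE in_take_leq ?size_tuple. Qed.

Definition permute_order (s : {perm 'I_n}) r : n.-tuple T :=
  [tuple tnth r (s i) | i < n].

Lemma permute_order_inj s : injective (permute_order s).
Proof.
move=> r r' rr'; apply: eq_from_tnth => i.
have := congr1 (fun t : n.-tuple T => tnth t (s^-1 i)%g) rr'.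
by rewrite !tnth_mktuple permKV.
Qed.

Lemma permute_order_uniq s r : uniq (permute_order s r) = uniq r.
Proof.
apply/tuple_uniqP/tuple_uniqP => inj i j.
  rewrite -(permKV s i) -(permKV s j) => eij; congr (s _); apply: inj.
  by rewrite !tnth_mktuple.
by rewrite !tnth_mktuple => /inj/perm_inj.
Qed.

(** Invariance of the uniform law under permuting positions, as a count: an injection of a finite
    type is bijective. *)
Lemma card_permute s (A : {set n.-tuple T}) :
  #|[set r | permute_order s r \in A]| = #|A|.
Proof.
have [g _ gK] := injF_bij (@permute_order_inj s).
rewrite -[RHS](card_imset _ (can_inj gK)); apply: eq_card => r.
rewrite finset.inE; apply/idP/imsetP => [rA|[r' r'A ->]]; last by rewrite gK.
by exists (permute_order s r) => //; apply: (@permute_order_inj s); rewrite gK.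
Qed.

Lemma index_permute s r e (i : 'I_n) : uniq r ->
  (index e (permute_order s r) == i) = (index e r == s i).
Proof.
move=> ro; have sro : uniq (permute_order s r) by rewrite permute_order_uniq.
pose t := Ordinal (orderP e sro).
have et : tnth r (s t) = e.
  by rewrite -[RHS](tnth_index e sro) tnth_mktuple.
have -> : index e r = s t by rewrite -{1}et index_order.
apply/idP/idP => [ti|/eqP/val_inj/perm_inj <-//].
by rewrite (_ : t = i) //; apply/val_inj/eqP.
Qed.

Lemma card_arrival_orders_gt0 : (0 < #|orders|)%N.
Proof.
have sz : size (enum T) == n by rewrite -cardE.
by apply/card_gt0P; exists (Tuple sz); rewrite finset.inE enum_uniq.
Qed.

(** Transposing two positions shows that [e] is equally often at each of the [n] positions. *)
Lemma card_order_index e (i : 'I_n) :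
  (n * #|[set r in orders | index e r == i]|)%N = #|orders|.
Proof.
pose A (j : 'I_n) := [set r in orders | index e r == j].
have AE j : #|A j| = #|A i|.
  rewrite -(card_permute (tperm i j) (A i)); apply: eq_card => r.
  rewrite !in_set permute_order_uniq; case: (boolP (uniq r)) => //= ro.
  by rewrite index_permute // tpermL.
transitivity (\sum_(j < n) #|A j|)%N.
  by rewrite (eq_bigr _ (fun j _ => AE j)) sum_nat_const card_ord.
transitivity (\sum_(j < n) \sum_(r in orders) (index e r == j))%N.
  apply: eq_bigr => j _; rewrite -big_mkcondr -sum1_card; apply: eq_bigl => r.
  by rewrite in_set.
rewrite exchange_big -sum1_card; apply: eq_bigr => r; rewrite in_set => ro.
rewrite (bigD1 (Ordinal (orderP e ro))) //= eqxx big1 ?addn0 // => j.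
by rewrite eq_sym -val_eqE /= => /negbTE ->.
Qed.

(** * Orders in which a fixed element meets no forbidden element *)

Section Avoidance.
Variables (k : nat) (F : {set T} -> {set T} -> {set T}) (e : T).
Hypothesis cardF : forall X Y : {set T}, e \in Y -> X \subset Y :\ e ->
  (#|F X Y| <= k)%N.

Definition hits r (j : 'I_n) : bool :=
  tnth r j \in F (arrived r j.+1) (arrived r (index e r).+1).

Definition avoiding s r : bool :=
  (s <= index e r)%N &&
  [forall j : 'I_n, (s <= j < index e r)%N ==> ~~ hits r j].

(** Their share among all orders is the probability [f s] that is averaged over the sample size
    later. *)
Definition avoiding_orders s := [set r in orders | avoiding s r].

(** * Shuffling the first [m] positions only *)

Section FixAbove.
Variables (m : nat) (s : {perm 'I_n}).
Hypothesis s_fix : forall j : 'I_n, (m <= j)%N -> s j = j.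

Lemma fix_above_lt (j : 'I_n) l : (m <= l)%N -> (s j < l)%N = (j < l)%N.
Proof.
move=> ml; have [mj|jm] := leqP m j; first by rewrite s_fix.
rewrite (leq_trans jm ml).
have [msj|sjm] := leqP m (s j); last exact: leq_trans sjm ml.
by move: jm; rewrite -(perm_inj (s_fix msj)) ltnNge msj.
Qed.

Lemma arrived_permute r l : uniq r -> (m <= l <= n)%N ->
  arrived (permute_order s r) l = arrived r l.
Proof.
move=> ro /andP[ml ln]; apply/setP => x.
have sro : uniq (permute_order s r) by rewrite permute_order_uniq.
rewrite !mem_arrived //; set i := Ordinal (orderP x sro).
have /eqP -> : index x r == s i by rewrite -index_permute.
by rewrite fix_above_lt.
Qed.

Lemma index_permute_above r : uniq r ->
  (m <= index e (permute_order s r))%N ->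
  index e (permute_order s r) = index e r.
Proof.
move=> ro mi; have sro : uniq (permute_order s r) by rewrite permute_order_uniq.
set i := Ordinal (orderP e sro).
have /eqP -> : index e r == s i by rewrite -index_permute.
by rewrite s_fix.
Qed.

Lemma forbidden_permute r l : uniq r ->
  (m <= index e (permute_order s r))%N -> (m <= l <= n)%N ->
  F (arrived (permute_order s r) l)
    (arrived (permute_order s r) (index e (permute_order s r)).+1)
  = F (arrived r l) (arrived r (index e r).+1).
Proof.
move=> ro mi ml; have ie := index_permute_above ro mi; rewrite ie in mi *.
by rewrite (arrived_permute ro ml) arrived_permute // leqW //= orderP.
Qed.

(** With a sample of size [m], avoidance depends only on the entries from position [m] on and on the
    sets of at least [m] first arrivals; the shuffle changes neither. *)
Lemma avoiding_permute r : uniq r ->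
  avoiding m (permute_order s r) -> avoiding m r.
Proof.
move=> ro /andP[mi /forallP av]; have ie := index_permute_above ro mi.
rewrite /avoiding -{1}ie mi; apply/forallP => j; apply/implyP => /andP[mj ji].
have := av j; rewrite ie mj ji /hits /= tnth_mktuple s_fix //.
by rewrite forbidden_permute // ?leqW // ltn_ord.
Qed.

End FixAbove.

(** Distinct positions hold distinct elements, and [e] arrives after position [m], so the bound on
    [F] applies to the first [m.+1] arrivals. *)
Lemma card_hits r m : r \in avoiding_orders m.+1 ->
  (#|[set i : 'I_n | (i <= m)%N &
      tnth r i \in F (arrived r m.+1) (arrived r (index e r).+1)]| <= k)%N.
Proof.
rewrite !in_set => /andP[ro /andP[mi _]].
rewrite -(card_imset _ (tnth_order_inj ro)).
have en := orderP e ro.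
apply: leq_trans
  (cardF (X := arrived r m.+1) (Y := arrived r (index e r).+1) _ _).
- apply: subset_leq_card; apply/fintype.subsetP => _ /imsetP[i + ->].
  by rewrite finset.inE => /andP[].
- by rewrite mem_arrived.
- apply/fintype.subsetP => x.
  rewrite in_setD1 !mem_arrived //; last exact: ltn_trans mi en.
  move=> xm; rewrite (leq_trans xm (leqW mi)) andbT.
  by apply: contraTneq xm => ->; rewrite -leqNgt.
Qed.

(* The orders in [avoiding_orders i.+1] are permuted by exchanging position [i]
   with any [j <= i], and at most [k] of these [j] hold a forbidden element. *)
Lemma card_hit (i : 'I_n) :
  (i.+1 * #|[set r in avoiding_orders i.+1 | hits r i]|
    <= k * #|avoiding_orders i.+1|)%N.
Proof.
set bad := [set r in _ | _].
pose H r (j : 'I_n) :=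
  tnth r j \in F (arrived r i.+1) (arrived r (index e r).+1).
have badE (j : 'I_n) : (j <= i)%N ->
    (#|bad| <= #|[set r in avoiding_orders i.+1 | H r j]|)%N.
  move=> ji; rewrite -(card_permute (tperm j i)).
  apply: subset_leq_card; apply/fintype.subsetP => r.
  rewrite !in_set permute_order_uniq => /andP[/andP[ro av] h].
  have fx (l : 'I_n) : (i < l)%N -> tperm j i l = l.
    move=> il; rewrite tpermD //; apply: contraTneq il => <-;
      by rewrite -leqNgt.
  rewrite ro (avoiding_permute fx ro av) /=.
  have /andP[mi _] := av.
  move: h; rewrite /hits (forbidden_permute fx ro mi) ?leqnn ?ltn_ord //.
  by rewrite tnth_mktuple tpermR.
pose w := widen_ord (ltn_ord i).
rewrite mulnC -[X in (_ * X)%N](card_ord i.+1) mulnC -sum_nat_const.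
apply: (@leq_trans
  (\sum_(j < i.+1) \sum_(r in avoiding_orders i.+1) H r (w j))%N).
  apply: leq_sum => j _; apply: leq_trans (badE (w j) _) _.
    by rewrite -ltnS /= ltn_ord.
  rewrite -big_mkcondr -sum1_card /= leq_eqVlt; apply/orP; left.
  by apply/eqP/eq_bigl => r; rewrite !in_set.
rewrite exchange_big mulnC -sum_nat_const /=; apply: leq_sum => r rav.
apply: leq_trans (card_hits rav).
have w_inj : injective w by move=> a b /(congr1 val) ab; exact/val_inj.
rewrite -big_mkcond /= sum1dep_card -(card_imset _ w_inj).
apply: subset_leq_card.
apply/fintype.subsetP => _ /imsetP[a + ->]; rewrite !in_set /H /= => ->.
by rewrite -ltnS ltn_ord.
Qed.

(** The recursion for [f] at sample size [i.+1], with denominators cleared and the term in [k] moved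
    to the right to avoid subtraction in [nat]. *)
Lemma card_avoiding_rec (i : 'I_n) :
  (i.+1 * #|orders| + n * i.+1 * #|avoiding_orders i.+1|
   <= n * (i.+1 * #|avoiding_orders i| + k * #|avoiding_orders i.+1|))%N.
Proof.
set bad := [set r in avoiding_orders i.+1 | hits r i].
(* Two disjoint families avoid from [i] on: the orders with [e] at position [i], and those that
   avoid from [i.+1] on and have no hit at [i]. *)
have H : (#|[set r in orders | index e r == i]| + #|avoiding_orders i.+1|
   <= #|avoiding_orders i| + #|bad|)%N.
  pose I := [set r : n.-tuple T | index e r == i].
  rewrite -(cardsID I (avoiding_orders i)) -addnA leq_add //.
    apply: subset_leq_card; apply/fintype.subsetP => r.
    rewrite in_setI !in_set => /andP[-> /eqP ie].
    rewrite ie eqxx andbT /avoiding ie leqnn.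
    by apply/forallP => j; rewrite ltnNge andbN.
  rewrite addnC; apply: leq_trans (leq_card_setU _ _).
  apply: subset_leq_card; apply/fintype.subsetP => r.
  rewrite in_setU in_setD !in_set => /andP[ro]; rewrite ro => /[dup] av -> /=.
  case: (boolP (hits r i)) => //= nh; case/andP: av => ii /forallP av.
  rewrite gtn_eqF //= /avoiding ltnW //=; apply/forallP => j; apply/implyP.
  move=> /andP[]; rewrite leq_eqVlt => /predU1P[/val_inj <- //|ij ji].
  by have := av j; rewrite ij ji.
have := card_hit i; rewrite -/bad -(card_order_index e i) => hb.
rewrite mulnCA -mulnA -!mulnDr leq_mul2l; apply/orP; right.
rewrite (leq_trans (leq_mul (leqnn i.+1) H)) // mulnDr.
by rewrite leq_add2l.
Qed.

End Avoidance.
End ArrivalOrders.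

(** * Averages under the binomial law, as polynomials in its parameter *)

Section Binomial.
Context {R : realType} (n : nat).
Implicit Types (x p : R) (f : nat -> R).

Definition binomial_poly s : {poly R} :=
  'C(n, s)%:R *: ('X^s * (1 - 'X) ^+ (n - s)).

Lemma horner_binomial_poly x s : (binomial_poly s).[x] = binomial_pmf n x s.
Proof. by rewrite /binomial_poly /binomial_pmf -[RHS]mulr_natl !hornerE. Qed.

Lemma deriv_binomial_poly s :
  'X * (binomial_poly s)^`() =
  s%:R *: binomial_poly s - s.+1%:R *: binomial_poly s.+1.
Proof.
rewrite /binomial_poly !scalerA -!natrM mul_bin_left.
rewrite !(poly.derivE, deriv_exp) subnS -[_ ^+ s.-1 *+ s]mulr_natl.
rewrite -[(_ * _) *+ (n - s)]mulr_natl -!mul_polyC !natrM !polyCM !polyC_natr.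
case: s => [|s]; case: (n - _)%N => [|m] /=; rewrite ?exprS; ring.
Qed.

(** The mean of the binomial law, from [s * 'C(n, s) = n * 'C(n - 1, s - 1)]. *)
Lemma sum_binomial_poly : \sum_(s < n.+1) s%:R *: binomial_poly s = n%:R *: 'X.
Proof.
rewrite big_ord_recl scale0r add0r /binomial_poly.
case: n => [|m]; first by rewrite big_ord0 scale0r.
under eq_bigr => i _ do rewrite scalerA -natrM -mul_bin_diag natrM -scalerA
  subSS exprS -mulrA scalerAr.
rewrite -scaler_sumr -mulr_sumr.
rewrite (_ : \sum_(i < _) _ = 1) ?mulr1 //.
rewrite -[RHS](expr1n _ m) -[in RHS](subrK 'X 1) exprDn.
by apply: eq_bigr => i _; rewrite scaler_nat mulrC.
Qed.

Lemma is_derive_exprV (x : R) k : x != 0 ->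
  is_derive x 1 (fun y : R => (y ^+ k)^-1) (- (k%:R / x ^+ k.+1)).
Proof.
move=> x0; apply: is_derive_eq.
  apply: is_deriveV; first by rewrite expf_neq0.
  by apply: DeriveDef; [exact: exprn_derivable|exact: exp_derive].
rewrite /GRing.scale /= mulr1 exprS.
case: k => [|k]; first by rewrite !mul0r mulr0 oppr0.
by rewrite /= !exprS; field; rewrite ?x0 ?expf_neq0.
Qed.

(* [- W p * p ^+ k] is [\int_p^1 (p / t) ^+ k dt]; an antiderivative stands for
   the integral so that [k = 1] and [k > 1] are treated alike. *)
Lemma sum_binomial_pmf_ge (k : nat) (f : nat -> R) (W : R -> R) p :
  (0 < n)%N -> 0 < p <= 1 -> (forall s, 0 <= f s) ->
  (forall s, (s < n)%N ->
     s.+1%:R / n%:R + (s.+1%:R - k%:R) * f s.+1 <= s.+1%:R * f s) ->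
  (forall x, 0 < x -> is_derive x 1 W (x ^+ k)^-1) -> W 1 = 0 ->
  - W p * p ^+ k <= \sum_(s < n.+1) binomial_pmf n p s * f s.
Proof.
move=> n0 /andP[p0 p1] f0 frec dW W1.
pose G := \sum_(s < n.+1) f s *: binomial_poly s.
have hornerG x : G.[x] = \sum_(s < n.+1) binomial_pmf n x s * f s.
  rewrite horner_sum; apply: eq_bigr => s _.
  by rewrite hornerZ horner_binomial_poly mulrC.
have bN : binomial_poly n.+1 = 0 by rewrite /binomial_poly bin_small ?scale0r.
(* The differential inequality for the average [G]. *)
have dG x : 0 < x <= 1 -> x * G^`().[x] - k%:R * G.[x] + x <= 0.
  move=> /andP[x0 x1].
  have xG' : x * G^`().[x] =
      \sum_(s < n.+1) f s * (s%:R * binomial_pmf n x s) -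
      \sum_(s < n.+1) f s * (s.+1%:R * binomial_pmf n x s.+1).
    rewrite -{1}[x]hornerX -hornerM raddf_sum mulr_sumr horner_sum -sumrB.
    apply: eq_bigr => s _; rewrite /= derivZ -scalerAr deriv_binomial_poly.
    rewrite hornerZ hornerD hornerN ![(_ *: binomial_poly _).[_]]hornerZ.
    by rewrite !horner_binomial_poly mulrBr.
  (* The mean turns the lone [x] into the average of [s / n], matching the term [s / n] of the
     recursion. *)
  have xE : x = \sum_(s < n.+1) s%:R / n%:R * binomial_pmf n x s.
    have /(congr1 (fun q => q.[x] / n%:R)) := sum_binomial_poly.
    rewrite /= hornerZ hornerX [n%:R * x]mulrC mulfK ?pnatr_eq0 -?lt0n // => nx.
    rewrite -[LHS]nx horner_sum mulr_suml; apply: eq_bigr => s _.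
    by rewrite hornerZ horner_binomial_poly mulrAC.
  rewrite xG' [X in _ + X <= 0]xE hornerG mulr_sumr.
  rewrite -addrA addrAC addrA -sumrB -[X in X - _]big_split /=.
  (* One sum loses its term at 0, which is at most 0; the other loses its last term, where the
     binomial coefficient vanishes. The rest is compared at weight [s.+1], where the recursion gives
     each sign. *)
  rewrite big_ord_recl big_ord_recr /=.
  rewrite (_ : binomial_pmf n x n.+1 = 0) ?mulr0 ?addr0; last first.
    by rewrite -horner_binomial_poly bN horner0.
  rewrite -[X in X <= 0]addrA -sumrB !(mul0r, mulr0, addr0) add0r.
  have b0 s : 0 <= binomial_pmf n x s.
    by apply: binomial_pmf_ge0; rewrite (ltW x0).
  rewrite -[leRHS]addr0 lerD //; first by rewrite oppr_le0 !mulr_ge0.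
  apply: sumr_le0 => s _; rewrite /bump /= add1n.
  have := ler_wpM2l (b0 s.+1) (frec s (ltn_ord s)).
  rewrite -subr_le0; apply: le_trans; rewrite le_eqVlt; apply/orP; left.
  by apply/eqP; ring.
(* The integrating factor [x ^- k] makes the inequality say that [D] decreases on []0, 1]]. At 1 the
   law sits at [n], so [D 1 = f n >= 0], whence [D p >= 0]. *)
pose D x := G.[x] / x ^+ k + W x.
have dD x : 0 < x ->
    is_derive x 1 D ((x * G^`().[x] - k%:R * G.[x] + x) / x ^+ k.+1).
  move=> x0; have dWx := dW _ x0.
  have x0' : x != 0 by rewrite gt_eqF.
  have dV := is_derive_exprV k x0'.
  apply: is_derive_eq.
  rewrite /GRing.scale /= exprS; field.
  by rewrite x0' expf_neq0.
have D1 : D 1 = f n.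
  rewrite /D W1 expr1n invr1 mulr1 addr0 horner_sum big_ord_recr big1 /= ?add0r.
    by rewrite /binomial_poly !hornerE subnn binn /= expr0 expr1n !mulr1.
  move=> i _; rewrite /binomial_poly !hornerE /= subrr expr0n subn_eq0.
  by rewrite leqNgt ltn_ord /= !mulr0.
have Dp : 0 <= D p.
  apply: (le_trans (f0 n)); rewrite -D1.
  apply: (@ler0_derive1_le_cc _ D p 1) => //; rewrite ?in_itv /= ?lexx ?p1 //.
  - move=> x; rewrite in_itv /= => /andP[/(lt_trans p0)/dD[]//].
  - move=> x; rewrite in_itv /= => /andP[/(lt_trans p0) x0 /ltW x1].
    rewrite derive1E; have [_ ->] := dD _ x0.
    apply: mulr_le0_ge0; first by apply: dG; rewrite x0.
    by rewrite invr_ge0 exprn_ge0 // ltW.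
  - apply: derivable_within_continuous => x; rewrite in_itv /= => /andP[px _].
    by have [] := dD x (lt_le_trans p0 px).
rewrite -hornerG mulNr lerNl -subr_ge0 opprK.
have pk : 0 < p ^+ k by exact: exprn_gt0.
rewrite -(@pmulr_lge0 _ (p ^+ k)^-1) ?invr_gt0 //.
by rewrite mulrDl mulfK ?gt_eqF // addrC.
Qed.

End Binomial.

(** * The sampling probability and the competitive ratio *)

Section Constants.
Context {R : realType} (k : nat).
Hypothesis k_gt0 : (0 < k)%N.
Local Notation p := (sampling_prob R k).

Lemma sampling_prob_gt0 : 0 < p.
Proof.
rewrite /sampling_prob; case: ifP => _.
  by rewrite invr_gt0 expR_gt0.
by rewrite powR_gt0 ?ltr0n.
Qed.

Lemma sampling_prob_le1 : p <= 1.
Proof.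
rewrite /sampling_prob; case: ifP => [_|k1].
  by rewrite invf_le1 ?expR_gt0 // -[leLHS]expR0 ler_expR.
have k2 : (1 < k)%N by case: k k_gt0 k1 => [|[]].
rewrite powRN invf_le1 ?powR_gt0 ?ltr0n //.
rewrite -[leLHS](powRr0 k%:R); apply: ler_powR; first by rewrite ler1n.
by rewrite divr_ge0 // subr_ge0 ler1n.
Qed.

(** The primitive is [ln x] for [k = 1] and [(1 - x ^- (k - 1)) / (k - 1)] otherwise. In both cases
    [- W p = 1], so the value is [p ^+ k]. *)
Lemma sampling_prob_primitive : exists W : R -> R,
  [/\ forall x : R, 0 < x -> is_derive x 1 W (x ^+ k)^-1, W 1 = 0 &
      - W p * p ^+ k = (competitive_ratio R k)^-1].
Proof.
rewrite /sampling_prob /competitive_ratio; case: ifP => [/eqP ->|k1].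
  exists (@ln R).
  split; [by move=> x /is_derive1_ln; rewrite expr1|exact: ln1|].
  by rewrite lnV ?posrE ?expR_gt0 // expRK opprK mul1r expr1.
case: k k_gt0 k1 => [//|[//|j] _ _].
set q := j.+2%:R `^ _.
have j1 : (j.+2%:R - 1 : R) = j.+1%:R by rewrite -[j.+2]addn1 natrD addrK.
have j0 : j.+1%:R != 0 :> R by rewrite pnatr_eq0.
have qX m : q ^+ m = j.+2%:R `^ (- (m%:R / j.+1%:R)).
  by rewrite -powR_mulrn ?powR_ge0 // -powRrM j1; congr (_ `^ _); field.
exists (fun x : R => (1 - (x ^+ j.+1)^-1) / j.+1%:R); split.
- move=> x x0; have x0' : x != 0 by rewrite gt_eqF.
  have dV := is_derive_exprV j.+1 x0'.
  apply: is_derive_eq.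
  by rewrite /GRing.scale /= !(mulr0, add0r) mul1r opprK mulrA mulVf // mul1r.
- by rewrite expr1n invr1 subrr mul0r.
- rewrite qX divff // powRN powRr1 // invrK qX powRN.
  rewrite -[in X in 1 - X]natr1 j1 -[- (_ / _)]mulNr opprB addrK divff //.
  by rewrite mul1r.
Qed.

End Constants.

(** * From forbidden sets to the competitive ratio *)

Lemma integral_binomial_prob_fin (R : realType) (n : nat) (p : R)
    (f : nat -> R) :
  0 <= p <= 1 -> (forall s, 0 <= f s) ->
  (\int[binomial_prob n p]_s (f s)%:E)%E =
  (\sum_(s < n.+1) binomial_pmf n p s * f s)%:E.
Proof.
move=> /andP[p0 p1] f0.
rewrite integral_binomial; last by move=> s; rewrite lee_fin.
by rewrite -sumEFin; apply: eq_bigr => s _; rewrite EFinM.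
Qed.

(** An optimal [e] is optimal in every set of arrivals that contains it, so it is selected in every
    avoiding order; the binomial average of [f] bounds its probability from below. *)
Lemma forbidden_sets_competitive (R : realType) (d : Order.disp_t)
    (T : finOrderType d) (M : matroid T) (k : nat) (A : sample_algorithm R T) :
  (0 < k)%N -> has_forbidden_sets M (sampling_prob R k) k A ->
  probability_competitive M (competitive_ratio R k) A.
Proof.
move=> k0 [_ [lawA _] [F [Fk sel]]] e eO.
set p := sampling_prob R k in lawA; set n := #|T| in lawA *.
have p0 : 0 < p := sampling_prob_gt0 k0.
have p1 : p <= 1 := sampling_prob_le1 k0.
have n0 : (0 < n)%N by apply/card_gt0P; exists e.
have nR : n%:R != 0 :> R by rewrite pnatr_eq0 -lt0n.
pose O := #|arrival_orders T|.
have O0 : 0 < O%:R :> R by rewrite ltr0n card_arrival_orders_gt0.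
have OR : O%:R != 0 :> R by rewrite gt_eqF.
pose N s := #|avoiding_orders (fun X Y => F X Y e) e s|.
have [W [dW W1 Wp]] := @sampling_prob_primitive R k k0.
have cardF (X Y : {set T}) : e \in Y -> X \subset Y :\ e -> (#|F X Y e| <= k)%N.
  by move=> eY XY; have [] := Fk X Y e (OPT_restrict eO eY) XY.
rewrite /prob_selected (@eq_measure_integral _ _ _ _ (binomial_prob n p));
  last by move=> U _ _; exact: lawA.
rewrite integral_binomial_prob_fin ?(ltW p0) //.
rewrite lee_fin -Wp.
apply: le_trans
  (@sum_binomial_pmf_ge R n k (fun s => (N s)%:R / O%:R) W p _ _ _ _ _ _) _.
- by [].
- by rewrite p0.
- by move=> s; rewrite divr_ge0.
- move=> s sn; have := card_avoiding_rec cardF (Ordinal sn).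
  rewrite -/n -/O -!/(N _) /= => rec.
  (* Multiplying by [n * O] turns the inequality for [f] into the counting recursion. *)
  rewrite -(ler_pM2r (_ : 0 < n%:R * O%:R)); last by rewrite mulr_gt0 // ltr0n.
  have -> : (s.+1%:R / n%:R + (s.+1%:R - k%:R) * ((N s.+1)%:R / O%:R)) *
        (n%:R * O%:R) =
      s.+1%:R * O%:R + n%:R * s.+1%:R * (N s.+1)%:R -
        n%:R * k%:R * (N s.+1)%:R :> R.
    by field; rewrite nR OR.
  have -> : s.+1%:R * ((N s)%:R / O%:R) * (n%:R * O%:R) =
      n%:R * s.+1%:R * (N s)%:R :> R.
    by field; rewrite OR.
  by rewrite lerBlDr -!natrM -!natrD ler_nat -!mulnA -mulnDr mulnA.
- by [].
apply: ler_sum => s _; rewrite ler_wpM2l ?binomial_pmf_ge0 ?(ltW p0) //.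
rewrite ler_pM2r ?invr_gt0 // ler_nat; apply: subset_leq_card.
apply/fintype.subsetP => r; rewrite !in_set => /andP[ru /andP[si /forallP av]].
rewrite ru /=; have it := orderP e ru; have et := tnth_index e ru.
rewrite -[X in X \in _]et; apply: sel; rewrite ?in_set -1?ltnS ?ltn_ord ?et //=.
  by apply: OPT_restrict => //; rewrite mem_arrived.
by move=> j sj; have := av j; rewrite sj.
Qed.

(** * The forbidden sets of the framed algorithm *)

Section FramedAlgorithm.
Context {d : Order.disp_t} {T : finOrderType d} {B : finType}.
Variables (k : nat) (M : matroid T) (MB : matroid (T + B)%type).
Variable pi : {set T} -> T -> B.
Hypothesis M_framed : framed k M MB.
Hypothesis pi_canonical : canonical_injections M MB pi.

Lemma arrived_drop (r : seq T) s (a b : seq T) z :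
  drop s r = a ++ z :: b ->
  z |: ([set x in a] :|: arrived r s) = arrived r (s + size a).+1.
Proof.
move=> dE; apply/setP => x.
rewrite in_setU1 in_setU !in_set -addnS takeD dE -cat_rcons.
rewrite take_size_cat ?size_rcons //.
by rewrite mem_cat mem_rcons in_cons orbA [RHS]orbC.
Qed.

Lemma nth_drop_cat (r : seq T) s (a b : seq T) x z :
  drop s r = a ++ z :: b -> nth x r (s + size a) = z.
Proof. by move=> dE; rewrite -nth_drop dE nth_cat ltnn subnn. Qed.

Lemma framed_has_forbidden_sets (R : realType) (p : R) :
  has_forbidden_sets M p k (framed_algorithm M MB pi p).
Proof.
have run0 s (r : #|T|.-tuple T) : exists2 N : {set T},
    output (framed_algorithm M MB pi p) s r = N &
    N \in indep M /\ {subset N <= drop s r}.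
  have [N NE [NI Nd _]] := framed_run_indep pi_canonical (arrived r s)
    (finset.set0, finset.set0) (drop s r) M_framed.
  by exists N; rewrite //= NE finset.setU0.
split.
- by move=> s r _ _; have [N -> []] := run0 s r.
- split=> // s r sn; rewrite in_set => ru i lis; have [N -> [_ Nd]] := run0 s r.
  apply/negP => /Nd; have := ru; rewrite -{1}(cat_take_drop s r) cat_uniq.
  case/and3P=> _ /hasPn tdr _ /tdr/negP[] /=.
  by rewrite in_take_leq ?size_tuple // index_order.
(* The forbidden elements are those of [OPT M X] whose charge would block [x]. Charges are injective
   on [OPT M X], so there are at most as many as elements of the frame circuit of [x]. *)
- exists (fun X _ x =>
    [set z in OPT M X | pi (OPT M X) z \in frame_circuit MB x]).
  split=> [X Y x _ _|s r sn].
    have [inj _] := pi_canonical (OPT_indep M X).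
    split.
      apply: fintype.subset_trans (OPT_subset M X).
      by apply/fintype.subsetP => z; rewrite in_set => /andP[].
    apply: leq_trans (card_frame_circuit x M_framed).
    rewrite -(card_in_imset (f := pi (OPT M X))); last first.
      by move=> a b; rewrite !in_set => /andP[aX _] /andP[bX _]; exact: inj.
    apply: subset_leq_card; apply/fintype.subsetP => _ /imsetP[z + ->].
    by rewrite in_set => /andP[].
  rewrite in_set => ru t st xO blocked; set x := tnth r t in xO blocked *.
  (* The run is cut just before [x], the arrival at position [t]. *)
  pose l1 := take (t - s) (drop s r).
  have l1s : (s + size l1)%N = t.
    by rewrite size_takel ?subnKC // size_drop size_tuple leq_sub2r // ltnW.
  have dE : drop s r = l1 ++ x :: drop t.+1 r.
    rewrite {1}/x (tnth_nth x) -drop_nth ?size_tuple //.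
    by rewrite -[in drop t r](subnK st) -drop_drop cat_take_drop.
  rewrite /= dE framed_run_cat /= (arrived_drop dE) l1s xO /=.
  case: ifP => [_|/negP[]].
    by apply: (fintype.subsetP (framed_run_mono _ _ _ _ _ _)); exact: setU11.
  (* A blocking [y] was charged by some [z] at position [s + size a], before [t]; this [z] is
     forbidden for [x], against [blocked]. *)
  rewrite finset.setI_eq0; apply/pred0P => y /=; apply/negbTE/negP => /andP[yx].
  case/framed_run_blocked => [|[a [z [b [l1E zO yE]]]]].
    by rewrite in_set0.
  have dE' : drop s r = a ++ z :: (b ++ x :: drop t.+1 r).
    by rewrite dE l1E -catA.
  rewrite (arrived_drop dE') in zO yE.
  have jt : (s + size a < t)%N.
    by rewrite -l1s l1E size_cat /= ltn_add2l -addSnnS leq_addr.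
  pose j := Ordinal (ltn_trans jt (ltn_ord t)).
  have := blocked j; rewrite leq_addr jt => /(_ isT) /=.
  by rewrite (tnth_nth z) (nth_drop_cat z dE') in_set zO -yE yx.
Qed.

End FramedAlgorithm.

Theorem theorem7 (R : realType) (k : nat) (d : Order.disp_t)
    (T : finOrderType d) (B : finType) (M : matroid T)
    (MB : matroid (T + B)%type) (pi : {set T} -> T -> B) :
  (0 < k)%N -> framed k M MB -> canonical_injections M MB pi ->
  (forall p : R, 0 <= p <= 1 ->
     has_forbidden_sets M p k (framed_algorithm M MB pi p)) /\
  probability_competitive M (competitive_ratio R k)
    (framed_algorithm M MB pi (sampling_prob R k)).
Proof.
move=> k_gt0 M_framed pi_canonical; split=> [p _|].
  exact: framed_has_forbidden_sets.
by apply: forbidden_sets_competitive => //; exact: framed_has_forbidden_sets.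
Qed.
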